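(* Let $\mathfrak{M}$ be a compact metric space, $\sigma:\mathfrak{M}\to\mathfrak{M}$ a homeomorphism, and $\mu$ an ergodic $\sigma$-invariant Borel probability measure on $\mathfrak{M}$. Let $J\subset\mathbb{R}$ be a compact interval, let $(a,\omega)\mapsto g_{a,\omega}$ be a continuous map $J\times\mathfrak{M}\to\mathrm{Homeo}^+(S^1)$, and let $\tilde g_{a,\omega}:\mathbb{R}\to\mathbb{R}$ be lifts of $g_{a,\omega}$ such that $\tilde g_{a,\omega}$ depends continuously on $a\in J$ and, for each $a\in J$, $\omega\mapsto\tilde g_{a,\omega}(0)$ is bounded and measurable. Assume that the cocycle depends smoothly on the parameter, i.e. for every $\omega\in\mathfrak{M}$ the function $(a,x)\mapsto \tilde g_{a,\omega}(x)$ is continuously differentiable on $J\times\mathbb{R}$. Assume moreover: 1) there is a constant $C>0$ such that for all $x\in\mathbb{R}$, $\omega\in\mathfrak{M}$, $a\in J$, $$\left|\frac{\partial \tilde g_{a,\omega}(x)}{\partial a}\right|\le C;$$ 2) setting $M_\omega=\max\left\{2,\ \max_{x\in\mathbb{R},\,a\in J}\left|\frac{\partial \tilde g_{a,\omega}(x)}{\partial x}\right|\right\}$, one has $$\int_{\mathfrak{M}}\log M_\omega\,d\mu(\omega)<\infty.$$ Let $\rho(a)$ denote the rotation number of the cocycle $(\omega,x)\mapsto(\sigma\omega,\tilde g_{a,\omega}(x))$. Then $\rho$ is log-Hölder continuous on $J$: there exists $R>0$ such that for any $a,a'\in J$ with $|a-a'|\le 1/2$, $$|\rho(a')-\rho(a)|\le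 R\left(\log|a'-a|^{-1}\right)^{-1}.$$
   Context: $S^1=\mathbb{R}/\mathbb{Z}$, $\pi:\mathbb{R}\to S^1$ is the natural covering map, and $\mathrm{Homeo}^+(S^1)$ is the space of orientation-preserving homeomorphisms of $S^1$ (with the uniform topology). A lift of $g\in\mathrm{Homeo}^+(S^1)$ is a continuous increasing map $\tilde g:\mathbb{R}\to\mathbb{R}$ with $g(\pi(x))=\pi(\tilde g(x))$; it satisfies $\tilde g(x+1)=\tilde g(x)+1$. For $n\ge 1$ put $$\tilde G_{n,a,\omega}=\tilde g_{a,\sigma^{n-1}\omega}\circ\cdots\circ\tilde g_{a,\sigma\omega}\circ\tilde g_{a,\omega}.$$ Rotation number: for each $a\in J$ there is (a well-known fact) a number $\rho(a)\in\mathbb{R}$ such that for $\mu$-a.e. $\omega\in\mathfrak{M}$ and every $x\in\mathbb{R}$ the limit $\lim_{n\to\infty}\frac1n(\tilde G_{n,a,\omega}(x)-x)$ exists and equals $\rho(a)$; this number is called the rotation number. For $a=a'$ the right-hand side of the log-Hölder estimate is interpreted as $0$. At endpoints of $J$ derivatives in $a$ are one-sided. *)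

(* Defs.v *)
From HB Require Import structures.
From mathcomp Require Import all_boot all_order all_algebra ring_quotient.
From mathcomp Require Import all_classical all_reals all_analysis.
From mathcomp Require Import ring.
Set Implicit Arguments.
Unset Strict Implicit.
Unset Printing Implicit Defensive.
Import Order.TTheory GRing.Theory Num.Theory.
Import numFieldNormedType.Exports.
Local Open Scope classical_set_scope.
Local Open Scope quotient_scope.
Local Open Scope ring_scope.

(* Measurable types of the library are pointed; a space carrying a probability
   measure is nonempty, so pointedness is no restriction on the base space. *)
#[short(type="pointedMetricType")]
HB.structure Definition PointedMetric (K : numDomainType) :=
  {M of Metric K M & Pointed M}.

Notation borel M := (g_sigma_algebraType (@open M)).

Section Circle.
Variable R : realType.

(* The predicate [Num.int], as a subgroup of R. *)
Definition integers : zmodClosed R :=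
  GRing.ZmodClosed.clone R (archimedean.Num.int_num_subdef (s := R)) _.

Definition circle : Type := Quotient.quot integers.

HB.instance Definition _ := Choice.on circle.
HB.instance Definition _ := GRing.Zmodule.on circle.

Definition circle_pi (x : R) : circle := \pi_(Quotient.quot integers) x.

Lemma circle_piP (x y : R) : circle_pi x = circle_pi y <-> x - y \is a Num.int.
Proof.
rewrite /circle_pi; split => [/eqP|h].
  by rewrite -Quotient.idealrBE.
by apply/eqP; rewrite -Quotient.idealrBE.
Qed.

Lemma circle_pi_surj (s : circle) : exists x : R, circle_pi x = s.
Proof. by exists (repr s); rewrite /circle_pi reprK. Qed.

Definition circle_dists (s t : circle) : set R :=
  [set d | exists u v, [/\ circle_pi u = s, circle_pi v = t & d = `|u - v|]].

(* Quotient distance: inf of |u - v| over representatives u, v. *)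
Definition circle_dist (s t : circle) : R := inf (circle_dists s t).

Lemma circle_dists_neq0 s t : circle_dists s t !=set0.
Proof.
have [u us] := circle_pi_surj s; have [v vt] := circle_pi_surj t.
by exists `|u - v|; exists u, v.
Qed.

Lemma circle_dists_lb s t : has_lbound (circle_dists s t).
Proof. by exists 0 => _ [u [v [_ _ ->]]]. Qed.

Lemma circle_dists_inf s t : has_inf (circle_dists s t).
Proof. by split; [exact: circle_dists_neq0|exact: circle_dists_lb]. Qed.

Lemma circle_distxx s : circle_dist s s = 0.
Proof.
apply/eqP; rewrite eq_le; apply/andP; split.
  have [u us] := circle_pi_surj s.
  by apply: ge_inf; [exact: circle_dists_lb|exists u, u; rewrite subrr normr0].
apply: lb_le_inf; first exact: circle_dists_neq0.
by move=> _ [u [v [_ _ ->]]].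
Qed.

Lemma circle_dist_lt s t e : circle_dist s t < e ->
  exists u v, [/\ circle_pi u = s, circle_pi v = t & `|u - v| < e].
Proof.
move=> ste; have e0 : 0 < e - circle_dist s t by rewrite subr_gt0.
have [_ [u [v [us vt ->]]]] := inf_adherent e0 (circle_dists_inf s t).
rewrite -/(circle_dist s t) => uve; exists u, v; split=> //.
by apply: (lt_le_trans uve); rewrite addrC subrK.
Qed.

Lemma circle_dist_le u v : circle_dist (circle_pi u) (circle_pi v) <= `|u - v|.
Proof. by apply: ge_inf; [exact: circle_dists_lb|exists u, v]. Qed.

Lemma circle_dist_positivity s t : circle_dist s t = 0 -> s = t.
Proof.
move=> st0.
have [|u [v [us vt uv]]] := @circle_dist_lt s t 2^-1; first by rewrite st0.
have [->|uv0] := eqVneq s t => //.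
have d0 : 0 < `|u - v|.
  rewrite normr_gt0 subr_eq0; apply: contra_neq uv0 => uv'.
  by rewrite -us -vt uv'.
have [|u' [v' [us' vt' uv']]] := @circle_dist_lt s t `|u - v|.
  by rewrite st0.
have /circle_piP iu : circle_pi u = circle_pi u' by rewrite us us'.
have /circle_piP iv : circle_pi v = circle_pi v' by rewrite vt vt'.
have i : (u - v) - (u' - v') \is a Num.int.
  have -> : (u - v) - (u' - v') = (u - u') - (v - v').
    by rewrite !opprD !opprK addrACA.
  exact: rpredB.
have [/eqP|n0] := eqVneq ((u - v) - (u' - v')) 0.
  by rewrite subr_eq0 => /eqP uvE; rewrite uvE ltxx in uv'.
have := norm_intr_ge1 i n0; rewrite leNgt => /negP[].
rewrite (le_lt_trans (ler_normB _ _))// [ltRHS](splitr 1) ltrD// ?div1r//.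
exact: lt_trans uv' uv.
Qed.

Lemma circle_dist_sym s t : circle_dist s t = circle_dist t s.
Proof.
rewrite /circle_dist; congr inf; apply/seteqP.
by split=> _ [u [v [us vt ->]]]; exists v, u; rewrite distrC.
Qed.

Lemma circle_dist_triangle t s r :
  circle_dist s r <= circle_dist s t + circle_dist t r.
Proof.
apply/ler_addgt0Pr => e e0.
have e20 : 0 < e / 2 by rewrite divr_gt0.
have [|u [v [us vt uv]]] := @circle_dist_lt s t (circle_dist s t + e / 2).
  by rewrite ltrDl.
have [|v' [w [vt' wr vw]]] := @circle_dist_lt t r (circle_dist t r + e / 2).
  by rewrite ltrDl.
have iv : v - v' \is a Num.int by apply/circle_piP; rewrite vt vt'.
have rE : circle_pi (w + (v - v')) = r.
  by rewrite -wr; apply/circle_piP; rewrite addrC addKr.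
have := circle_dist_le u (w + (v - v')); rewrite us rE => /le_trans; apply.
have -> : u - (w + (v - v')) = (u - v) + (v' - w).
  by ring.
rewrite (le_trans (ler_normD _ _))//.
rewrite [in leRHS](splitr e) addrACA.
by rewrite lerD// ltW.
Qed.

HB.instance Definition _ := @isMetric.Build R circle circle_dist
  circle_distxx circle_dist_positivity circle_dist_sym circle_dist_triangle.

End Circle.

Definition homeomorphism (S T : topologicalType) (f : S -> T) :=
  continuous f /\
  exists h : T -> S, [/\ continuous h, cancel f h & cancel h f].

Section Lifts.
Variable R : realType.

Definition is_lift (f : R -> R) (g : circle R -> circle R) :=
  [/\ continuous f, {homo f : x y / x < y}
    & forall x, g (circle_pi x) = circle_pi (f x)].

(* A homeomorphism of the circle preserves orientation iff it has an increasing
   lift. *)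
Definition homeo_plus : set (circle R -> circle R) :=
  [set g | homeomorphism g /\ exists f, is_lift f g].

End Lifts.

Section ParameterDerivative.
Variable R : realType.
Implicit Types (J : set R) (f : R -> R).

Definition derivable_in J f (a : R) :=
  cvg ((fun b => (f b - f a) / (b - a)) @ within J a^').

(* The derivative at a of the restriction of f to J, one-sided when a is an
   endpoint of the interval J. *)
Definition derive_in J f (a : R) : R :=
  lim ((fun b => (f b - f a) / (b - a)) @ within J a^').

Definition C1_strip J (F : R -> R -> R) :=
  [/\ forall a x, J a -> derivable_in J (F^~ x) a,
      forall a x, J a -> derivable (F a) x 1,
      {within J `*` setT,
        continuous (fun p : R * R => derive_in J (F^~ p.2) p.1)}
    & {within J `*` setT, continuous (fun p : R * R => derive1 (F p.1) p.2)}].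

End ParameterDerivative.

Section Dynamics.
Variables (R : realType) (M : pointedMetricType R).
Implicit Types (mu : probability (borel M) R) (sigma : M -> M).

Definition invariant_measure mu sigma :=
  forall A : set (borel M), measurable A -> mu (sigma @^-1` A) = mu A.

Definition ergodic mu sigma := invariant_measure mu sigma /\
  forall A : set (borel M), measurable A -> sigma @^-1` A = A ->
    mu A = 0%E \/ mu A = 1%E.

Implicit Type gt : R -> M -> R -> R.

(* lift_iter sigma gt n a w is the composition
   gt a (sigma^(n-1) w) o ... o gt a (sigma w) o gt a w. *)
Fixpoint lift_iter sigma gt (n : nat) (a : R) (w : M) : R -> R :=
  if n is m.+1 then gt a (iter m sigma w) \o lift_iter sigma gt m a w else id.

Definition is_rotation_number mu sigma gt (a r : R) :=
  {ae mu, forall w : borel M, forall x : R,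
    (fun n : nat => (lift_iter sigma gt n a w x - x) / n%:R) @ \oo --> r}.

(* The supremum is attained: the derivative is 1-periodic in x and continuous. *)
Definition max_slope (J : set R) gt (w : M) : R :=
  Num.max 2 (sup [set d | exists a x, J a /\ d = `|derive1 (gt a w) x|]).

End Dynamics.

(* Main.v *)
(* Fix a, a' and put e = |a' - a|.  Compare the orbits of the two lifted
   cocycles from the same point.  One step multiplies their distance by at most
   M_w and adds at most C e, so the orbits need a stretch of time over which the
   logarithms of the M_w add up to about ln (1/e) to drift apart by a constant
   amount.  When that happens, the comparison restarts from the current point of
   the first orbit: a lift of degree one does not increase integer distances, so
   what was accumulated before is carried along unchanged.  After n steps the
   distance is therefore O(1 + S_n / ln (1/e)), where S_n is the Birkhoff sum of
   ln M.  Dividing by n, Fatou's lemma and the invariance of mu bound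
   |rho a' - rho a| ln (1/e) by a multiple of the integral of ln M. *)
Require Import Defs.
From HB Require Import structures.
From mathcomp Require Import all_boot all_order all_algebra ring_quotient.
From mathcomp Require Import all_classical all_reals all_analysis.
From mathcomp Require Import measurable_realfun ring lra.
Import Order.TTheory GRing.Theory Num.Theory.
Import numFieldNormedType.Exports.
Local Open Scope classical_set_scope.
Local Open Scope ring_scope.

(** * Divergence of two orbits driven by nearby maps of the line *)

Section OrbitGap.
Variable R : realType.

(** The point [z] separates the old gap [k], which maps of degree one do not enlarge, from the
    recent gap [d], to which the Lipschitz bound applies. *)
Lemma split_gap (x y k d : R) : 0 <= k -> 0 <= d -> `|y - x| <= k + d ->
  exists2 z, `|y - z| <= k & `|z - x| <= d.
Proof.
move=> k0 d0; rewrite ler_norml => /andP[yx1 yx2].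
have [yx|yx] := lerP (y - x) (- k).
  by exists (y + k); rewrite ler_norml; apply/andP; split; lra.
have [yx'|yx'] := lerP k (y - x).
  by exists (y - k); rewrite ler_norml; apply/andP; split; lra.
by exists x; rewrite ler_norml; apply/andP; split; lra.
Qed.

Variables (F F' : nat -> R -> R) (m : nat -> R) (c : nat) (e : R).
Hypotheses (c_gt0 : (0 < c)%N) (e_gt0 : 0 < e) (e_lt1 : e < 1).
Hypothesis m_ge2 : forall n, 2 <= m n.
Hypothesis F'_lip : forall n x y, `|F' n x - F' n y| <= m n * `|x - y|.
Hypothesis F'_int : forall n x y (k : nat), `|x - y| <= k%:R ->
  `|F' n x - F' n y| <= k%:R.
Hypothesis FF' : forall n x, `|F' n x - F n x| <= c%:R * e.
Variables x y : nat -> R.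
Hypotheses (xS : forall n, x n.+1 = F n (x n))
  (yS : forall n, y n.+1 = F' n (y n)) (xy0 : x 0%N = y 0%N).

(** The two bounds differ in the treatment of [d]: the first uses the slope [m n]; the second uses
    [F'_int] at the integer [c], for the step at which the first exceeds [c]. *)
Lemma orbit_gap_step n (k : nat) (d : R) : 0 <= d ->
  `|y n - x n| <= k%:R + d ->
  `|y n.+1 - x n.+1| <= k%:R + (m n * d + c%:R * e) /\
  (d <= c%:R -> `|y n.+1 - x n.+1| <= k%:R + (c%:R + c%:R * e)).
Proof.
move=> d0 /(split_gap _ _ _ _ (ler0n _ _) d0) [z yz zx].
rewrite xS yS.
have -> : F' n (y n) - F n (x n) = (F' n (y n) - F' n z)
   + (F' n z - F' n (x n) + (F' n (x n) - F n (x n))) by ring.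
split => [|dc].
  apply: (le_trans (ler_normD _ _)); apply: lerD; first exact: F'_int.
  apply: (le_trans (ler_normD _ _)); apply: lerD; last exact: FF'.
  apply: (le_trans (F'_lip _ _ _)); rewrite ler_wpM2l//.
  by rewrite (le_trans _ (m_ge2 n)).
apply: (le_trans (ler_normD _ _)); apply: lerD; first exact: F'_int.
apply: (le_trans (ler_normD _ _)); apply: lerD; last exact: FF'.
by apply: F'_int; exact: le_trans dc.
Qed.

(* [k] counts how often the two orbits drifted apart by about [c] and the
   comparison was restarted; each such drift from scale [c * e] to scale [c]
   uses up an amount [ln e^-1] of the sum of the [ln (m i)]. *)
Lemma orbit_gap_invariant n : exists (k : nat) (d : R), [/\ 0 <= d, d <= c%:R,
  `|y n - x n| <= (2 * c * k)%:R + d &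
  ln ((d + c%:R * e) / (c%:R * e)) + k%:R * ln e^-1 <= \sum_(i < n) ln (m i)].
Proof.
have c0 : 0 < c%:R :> R by rewrite ltr0n.
have ce0 : 0 < c%:R * e by rewrite mulr_gt0.
elim: n => [|n [k [d [d0 dc yxd lnd]]]].
  exists 0%N, 0; split => //; first by rewrite xy0 subrr normr0 muln0 addr0.
  by rewrite add0r divff ?gt_eqF// ln1 mul0r addr0 big_ord0.
have [step1 /(_ dc) step2] := orbit_gap_step _ _ _ d0 yxd.
have mn2 := m_ge2 n; have mn0 : 0 < m n by rewrite (lt_le_trans _ mn2).
have dce0 : 0 < d + c%:R * e by rewrite ltr_wpDl.
rewrite big_ord_recr/=.
have lnM : ln (m n * (d + c%:R * e) / (c%:R * e)) =
    ln (m n) + ln ((d + c%:R * e) / (c%:R * e)).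
  by rewrite -mulrA lnM// posrE// divr_gt0.
have md0 : 0 <= m n * d by rewrite mulr_ge0// ltW.
(* Here [2 <= m n] enters: multiplying [c%:R * e] by [m n] pays both for the error of this step and
   for the shift inside the logarithm. *)
have le2 : 2 * (c%:R * e) <= m n * (c%:R * e) by rewrite ler_wpM2r// ltW.
have [small|big] := leP (m n * d + c%:R * e) c%:R.
  exists k, (m n * d + c%:R * e); split => //.
    by rewrite addr_ge0// ltW.
  have : ln ((m n * d + c%:R * e + c%:R * e) / (c%:R * e)) <=
         ln (m n * (d + c%:R * e) / (c%:R * e)).
    rewrite ler_ln ?posrE; first last.
    - by rewrite divr_gt0// mulr_gt0.
    - by rewrite divr_gt0// -addrA ltr_wpDl// addr_gt0.
    by rewrite ler_pM2r ?invr_gt0// mulrDr -addrA lerD2l; lra.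
  rewrite lnM; lra.
(* Restart: since [e < 1], the new gap is at most [2 * c * k + c + c * e], hence at most
   [2 * c * k.+1]. *)
exists k.+1, 0; split => //.
  apply: (le_trans step2); rewrite mulnS addr0 natrD [leRHS]addrC lerD2l natrM.
  have : c%:R * e <= c%:R * 1 by rewrite ler_pM2l// ltW.
  lra.
rewrite add0r divff ?gt_eqF// ln1 add0r -natr1 mulrDl mul1r.
have : ln e^-1 <= ln (m n * (d + c%:R * e) / (c%:R * e)).
  rewrite ler_ln ?posrE ?invr_gt0//; last by rewrite divr_gt0// mulr_gt0.
  have -> : e^-1 = c%:R / (c%:R * e).
    by rewrite invfM mulrA divff ?gt_eqF// mul1r.
  by rewrite ler_pM2r ?invr_gt0// mulrDr; lra.
rewrite lnM; lra.
Qed.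

Lemma orbit_gap n : `|y n - x n| * ln e^-1 <=
  2 * c%:R * (\sum_(i < n) ln (m i)) + c%:R * ln e^-1.
Proof.
have c0 : 0 < c%:R :> R by rewrite ltr0n.
have ce0 : 0 < c%:R * e by rewrite mulr_gt0.
have L0 : 0 <= ln e^-1 by rewrite ln_ge0// invf_ge1// ltW.
have [k [d [d0 dc yx lnd]]] := orbit_gap_invariant n.
apply: (@le_trans _ _ (((2 * c * k)%:R + c%:R) * ln e^-1)).
  by rewrite ler_wpM2r// (le_trans yx)// lerD2l.
rewrite mulrDl lerD2r !natrM -mulrA ler_pM2l ?mulr_gt0//.
(* The first logarithm of the invariant is nonnegative; dropping it bounds the number of
   restarts. *)
apply: le_trans lnd; rewrite lerDr ln_ge0//.
by rewrite ler_pdivlMr// mul1r lerDr.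
Qed.

End OrbitGap.

(** * Lifts of injective circle maps have degree one *)

Section LiftDegree.
Variable R : realType.
Variables (g : circle R -> circle R) (f : R -> R).
Hypotheses (g_inj : injective g) (fg : is_lift f g).

Let f_lt : {homo f : x y / x < y}. Proof. by case: fg. Qed.

Lemma lift_le : {homo f : x y / x <= y}.
Proof.
by move=> x y; rewrite le_eqVlt => /predU1P[->//|/f_lt/ltW].
Qed.

Lemma lift_IVT (x y v : R) : x <= y -> f x <= v -> v <= f y ->
  exists2 z, x <= z <= y & f z = v.
Proof.
move=> xy xv vy; have [fc _ _] := fg.
have vI : Num.min (f x) (f y) <= v <= Num.max (f x) (f y).
  by rewrite ge_min xv/= le_max vy orbT.
have [z] := IVT xy (continuous_subspaceT fc) vI.
by rewrite in_itv/= => zxy <-; exists z.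
Qed.

(** Otherwise [f] takes the value [f x + 1] at some [z] in [[x, y]]. Then [z] and [x] have the same
    image on the circle, so [z - x] is an integer in [[0, 1)] by injectivity, and [z = x] is
    absurd. *)
Lemma lift_lt1 (x y : R) : x <= y -> y < x + 1 -> f y < f x + 1.
Proof.
move=> xy yx1; rewrite ltNge; apply/negP => fxy.
have fx1 : f x <= f x + 1 by rewrite lerDl.
have [z /andP[xz zy] fz] := lift_IVT _ _ _ xy fx1 fxy.
have [_ _ gf] := fg.
have /g_inj/circle_piP zx_int : g (circle_pi z) = g (circle_pi x).
  by rewrite !gf; apply/circle_piP; rewrite fz addrAC subrr add0r rpred1.
have [zx0|zx0] := eqVneq (z - x) 0.
  by move: fz; rewrite (subr0_eq zx0); lra.
have := norm_intr_ge1 zx_int zx0.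
by rewrite ger0_norm ?subr_ge0// leNgt ltrBlDl (le_lt_trans zy).
Qed.

(** The increment over a period is a positive integer. Were it at least 2, the value [f x + 3 / 2]
    would be reached before [x + 1], against [lift_lt1]. *)
Lemma liftD1 (x : R) : f (x + 1) = f x + 1.
Proof.
have [_ _ gf] := fg.
have int1 : f (x + 1) - f x \is a Num.int.
  by apply/circle_piP; rewrite -!gf; congr g; apply/circle_piP;
    rewrite addrAC subrr add0r rpred1.
have fx1 : f x < f (x + 1) by apply: f_lt; rewrite ltrDl.
have ge1 : 1 <= f (x + 1) - f x.
  have := norm_intr_ge1 int1; rewrite gtr0_norm ?subr_gt0//; apply.
  by rewrite subr_eq0 gt_eqF.
have int2 : f (x + 1) - f x - 1 \is a Num.int by rewrite rpredB// rpred1.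
have [e|n0] := eqVneq (f (x + 1) - f x - 1) 0; first by lra.
have := norm_intr_ge1 int2 n0; rewrite ger0_norm ?subr_ge0// => ge2.
have [z /andP[xz zx1] fz] : exists2 z, x <= z <= x + 1 & f z = f x + 3 / 2.
  by apply: lift_IVT; lra.
have : z < x + 1.
  by rewrite lt_neqAle zx1 andbT; apply/eqP => ze; move: fz; rewrite ze; lra.
by move=> /(lift_lt1 _ _ xz); lra.
Qed.

Lemma liftDn (x : R) (k : nat) : f (x + k%:R) = f x + k%:R.
Proof.
elim: k => [|k IHk]; first by rewrite !addr0.
by rewrite -natr1 !addrA liftD1 IHk.
Qed.

(** Monotonicity and commutation with integer translations; this is why the comparison of orbits
    measures old gaps by integers. *)
Lemma lift_int_gap (x y : R) (k : nat) :
  `|x - y| <= k%:R -> `|f x - f y| <= k%:R.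
Proof.
wlog xy : x y / y <= x.
  move=> H; have [/H//|yx] := leP y x.
  by rewrite distrC [`|f x - f y|]distrC; apply: H; exact: ltW.
rewrite !ger0_norm ?subr_ge0 ?lift_le//.
by rewrite !lerBlDl -liftDn; exact: lift_le.
Qed.

Lemma derive1_liftDn (x : R) (k : nat) : derive1 f (x + k%:R) = derive1 f x.
Proof.
rewrite /derive1.
have -> // : (fun h => h^-1 *: (f (h + (x + k%:R)) - f (x + k%:R))) =
             (fun h => h^-1 *: (f (h + x) - f x)).
by apply/funext => h; rewrite addrA !liftDn opprD addrACA subrr addr0.
Qed.

Lemma derive1_lift_unit (x : R) :
  exists2 y, 0 <= y <= 1 & derive1 f x = derive1 f y.
Proof.
have xE : x = x - (Num.floor x)%:~R + (Num.floor x)%:~R by rewrite subrK.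
exists (x - (Num.floor x)%:~R).
  rewrite subr_ge0 floor_le/= lerBlDl.
  by have /ltW := floorD1_gt x; rewrite intrD.
move: (Num.floor x) xE => [n|n] xE.
  by rewrite {1}xE derive1_liftDn.
by rewrite NegzE mulrNz opprK derive1_liftDn.
Qed.

End LiftDegree.

(** * Mean value estimates in the space variable and in the parameter *)

Section MeanValue.
Variable R : realType.
Implicit Types (f : R -> R) (m : R).

Lemma is_derive_in (J : set R) f (c : R) : nbhs c J ->
  derivable_in J f c -> is_derive c 1 f (derive_in J f c).
Proof.
move=> /nbhs_ballP[d /= d0 dJ] dfc.
have cvgh : h^-1 *: (f (h *: 1 + c) - f c) @[h --> (0 : R)^'] -->
    derive_in J f c.
  apply/cvgrPdist_lt => e e0.
  have /cvgrPdist_lt /(_ _ e0) := dfc.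
  rewrite near_withinE /dnbhs near_withinE => /nbhs_ballP[d' /= d'0 H].
  rewrite /dnbhs near_withinE; apply/nbhs_ballP; exists (Num.min d d').
    by rewrite /= lt_min d0.
  move=> h; rewrite /ball/= sub0r normrN lt_min => /andP[hd hd'] h0.
  have /H : ball c d' (h + c) by rewrite /ball/= opprD addrCA subrr addr0 normrN.
  rewrite addrK -(mulrC h^-1) /GRing.scale/= mulr1; apply.
    by rewrite -subr_eq0 addrK.
  by apply: dJ; rewrite /ball/= opprD addrCA subrr addr0 normrN.
apply: DeriveDef; last exact/cvg_lim.
by apply/cvg_ex; exists (derive_in J f c).
Qed.

Lemma lip_of_derive1 f m : (forall x, derivable f x 1) ->
  (forall x, `|derive1 f x| <= m) -> forall x y, `|f x - f y| <= m * `|x - y|.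
Proof.
move=> df dfm x y.
wlog yx : x y / y <= x.
  move=> H; have [/H//|xy] := leP y x.
  by rewrite distrC [`|x - y|]distrC; apply: H; exact: ltW.
have [||c _ ->] := @MVT_segment R f (derive1 f) y x yx.
- by move=> z _; rewrite derive1E; exact/derivableP.
- apply: derivable_within_continuous => z _; exact: df.
by rewrite normrM ler_wpM2r.
Qed.

(** The mean value theorem on [[b, a]] asks for derivatives only at interior points, where [J] is a
    neighbourhood and [is_derive_in] turns the derivative within [J] into an ordinary one. *)
Lemma lip_of_derive_in (j0 j1 : R) (J : set R) f m : J = [set` `[j0, j1]] ->
  {within J, continuous f} ->
  (forall a, J a -> derivable_in J f a) ->
  (forall a, J a -> `|derive_in J f a| <= m) ->
  forall a b, J a -> J b -> `|f a - f b| <= m * `|a - b|.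
Proof.
move=> -> fc df dfm a b.
wlog ba : a b / b <= a.
  move=> H Ja Jb; have [ba|ab] := leP b a; first exact: H.
  by rewrite distrC [`|a - b|]distrC; apply: H => //; exact: ltW.
rewrite /= !in_itv/= => /andP[ja aj] /andP[jb bj].
have sub : `[b, a] `<=` `[j0, j1].
  move=> z /=; rewrite !in_itv/= => /andP[bz za].
  by rewrite (le_trans jb)//= (le_trans za).
have [||c cba ->] := @MVT_segment R f (derive_in [set` `[j0, j1]] f) b a ba.
- move=> z; rewrite in_itv/= => /andP[bz za]; apply: is_derive_in.
    have : nbhs z [set` `]b, a[] by apply: near_in_itvoo; rewrite in_itv/= bz.
    apply: filterS => t; rewrite /= in_itv/= => /andP[bt ta]; apply: sub => /=.
    by rewrite in_itv/= !ltW.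
  by apply: df; apply: sub => /=; rewrite in_itv/= !ltW.
- exact: continuous_subspaceW fc.
by rewrite normrM ler_wpM2r//; apply: dfm; exact: sub.
Qed.

Lemma pointwise_cont (X : topologicalType) (A : set X) (F : X -> R -> R) x :
  {within A, continuous (fun a => (F a : {uniform R -> R}))} ->
  {within A, continuous (F^~ x)}.
Proof.
move=> Fc a; apply/cvgrPdist_lt => e e0.
apply: (Fc a [set h | `|F a x - h x| < e]).
apply/uniform_nbhs; exists [set p | ball p.1 e p.2]; split.
  exact: (entourage_ball _ (PosNum e0)).
by move=> h; exact.
Qed.

End MeanValue.

(** * The maximal slope as a genuine bound on derivatives *)

Lemma max_slope_ge2 (R : realType) (M : pointedMetricType R) (J : set R)
    (gt : R -> M -> R -> R) (w : M) : 2 <= max_slope J gt w.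
Proof. by rewrite le_max lexx. Qed.

Section MaxSlope.
Variables (R : realType) (M : pointedMetricType R).
Variables (j0 j1 : R).
Let J : set R := [set` `[j0, j1]].
Variables (gt : R -> M -> R -> R) (w : M).
Hypothesis lift : forall a, J a -> exists2 g : circle R -> circle R,
  injective g & is_lift (gt a w) g.
Hypothesis gt_C1 : C1_strip J (fun a x => gt a w x).

(** Periodicity of the derivative reduces the line to [[0, 1]], and a continuous function on the
    compact set [J] times [[0, 1]] is bounded. Only then is [sup] an actual upper bound. *)
Lemma max_slope_has_ubound :
  has_ubound [set d | exists a x, J a /\ d = `|derive1 (gt a w) x|].
Proof.
have [_ _ _ dc] := gt_C1.
have cpt : compact (J `*` (`[0, 1] : set R)).
  by apply: compact_setX; exact: segment_compact.
have dc' : {within J `*` [set` `[0, 1]],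
    continuous (fun p : R * R => derive1 (gt p.1 w) p.2)}.
  by apply: continuous_subspaceW dc => -[a x] [].
have /compact_bounded [N [_ bN]] := continuous_compact dc' cpt.
exists (N + 1) => _ [a [x [Ja ->]]].
have [g g_inj fg] := lift _ Ja.
have [y y01 ->] := derive1_lift_unit _ _ _ g_inj fg x.
apply: (bN (N + 1)); first by rewrite ltrDl.
by exists (a, y) => //; split => //=; rewrite in_itv.
Qed.

Lemma derive1_le_max_slope a x : J a ->
  `|derive1 (gt a w) x| <= max_slope J gt w.
Proof.
move=> Ja; rewrite /max_slope le_max; apply/orP; right.
by apply: ub_le_sup; [exact: max_slope_has_ubound|exists a, x].
Qed.

End MaxSlope.

(** * Stability of lift increments under uniform perturbation on the circle *)

Section Increments.
Variable R : realType.

(** Closeness on the circle determines the difference of the two increments up to an integer and an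
    error below [2 * d]. Both increments lie in [(0, 1)], and the margins imposed on that of [f]
    force the integer to be 0. *)
Lemma lift_increment_close (f f' : R -> R) (g g' : circle R -> circle R)
    (p q d : R) :
  injective g -> injective g' -> is_lift f g -> is_lift f' g' ->
  p < q -> q < p + 1 ->
  2 * d <= f q - f p -> 2 * d <= 1 - (f q - f p) ->
  (forall s, circle_dist (g s) (g' s) < d) ->
  `|(f' q - f' p) - (f q - f p)| < 2 * d.
Proof.
move=> gi gi' fg fg' pq qp1 dle dle1 gg'.
have [_ f'_lt f'g'] := fg'; have [_ _ fgE] := fg.
have fqp1 := lift_lt1 _ _ _ gi fg _ _ (ltW pq) qp1.
have fqp1' := lift_lt1 _ _ _ gi' fg' _ _ (ltW pq) qp1.
have fpq' := f'_lt _ _ pq.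
have close s : exists u v, [/\ f s - u \is a Num.int, f' s - v \is a Num.int
    & `|u - v| < d].
  have := gg' (circle_pi s); rewrite fgE f'g' => /circle_dist_lt[u [v [us vs uv]]].
  by exists u, v; split=> //; apply/circle_piP; rewrite ?us ?vs.
have [u [v [fu f'v uv]]] := close p; have [u' [v' [fu' f'v' uv']]] := close q.
have int : (f' q - v') - (f' p - v) - ((f q - u') - (f p - u)) \is a Num.int.
  exact: rpredB (rpredB f'v' f'v) (rpredB fu' fu).
move: uv uv'; rewrite !ltr_norml => /andP[? ?] /andP[? ?].
have [i0|n0] := eqVneq ((f' q - v') - (f' p - v) - ((f q - u') - (f p - u))) 0.
  by apply/andP; split; lra.
have := norm_intr_ge1 int n0; rewrite ler_normr => /orP[?|?]; lra.
Qed.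

End Increments.

(** * Measurability of the logarithm of the maximal slope *)

Section Measurability.
Variables (R : realType) (M : pointedMetricType R).
Variables (j0 j1 : R) (j01 : j0 <= j1).
Let J : set R := [set` `[j0, j1]].
Variables (g : R -> M -> circle R -> circle R) (gt : R -> M -> R -> R).
Hypothesis g_cont : {within J `*` [set: M], continuous
    (fun p : R * M => (g p.1 p.2 : {uniform circle R -> circle R}))}.
Hypothesis g_inj : forall a w, J a -> injective (g a w).
Hypothesis gt_lift : forall a w, J a -> is_lift (gt a w) (g a w).
Hypothesis gt_C1 : forall w, C1_strip J (fun a x => gt a w x).

Let lift w a : J a -> exists2 h : circle R -> circle R,
  injective h & is_lift (gt a w) h.
Proof. by move=> Ja; exists (g a w); [exact: g_inj|exact: gt_lift]. Qed.

Lemma lip_max_slope w a x y : J a ->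
  `|gt a w x - gt a w y| <= max_slope J gt w * `|x - y|.
Proof.
move=> Ja; have [_ dx _ _] := gt_C1 w.
apply: lip_of_derive1 => z; first exact: dx.
by apply: derive1_le_max_slope => // b; exact: lift.
Qed.

(** Trades derivatives for increments over less than a period, which can be controlled as [w]
    varies. One direction is the Lipschitz bound, the other the definition of the derivative. *)
Lemma max_slope_gtP w (c : R) : 2 <= c -> c < max_slope J gt w <->
  exists a p q, [/\ J a, p < q, q < p + 1
    & c * (q - p) < gt a w q - gt a w p].
Proof.
move=> c2; split; last first.
  move=> [a [p [q [Ja pq qp1 slope]]]].
  have := lip_max_slope w a q p Ja.
  have := ler_norm (gt a w q - gt a w p).
  rewrite (gtr0_norm (_ : 0 < q - p)) ?subr_gt0// => le1 le2.
  have := lt_le_trans slope (le_trans le1 le2).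
  by rewrite ltr_pM2r// subr_gt0.
rewrite lt_max ltNge c2/= => /sup_gt[].
  by exists `|derive1 (gt j0 w) 0|, j0, 0; split => //; rewrite /J/= in_itv/= lexx.
move=> _ [a [x [Ja ->]]] cd.
have [_ /(_ a x Ja) dx _ _] := gt_C1 w.
have cvgd : `|h^-1 *: (gt a w (h + x) - gt a w x)| @[h --> (0 : R)^'] -->
    `|derive1 (gt a w) x|.
  apply: cvg_norm; move: dx; rewrite /derivable /derive1.
  by under eq_fun do rewrite /GRing.scale/= mulr1.
have [h [hn0 h1 hc]] : exists h : R, [/\ h != 0, `|h| < 1 &
    c < `|h^-1 *: (gt a w (h + x) - gt a w x)|].
  have := cvgd _ (lt_nbhsr cd).
  rewrite nbhs_simpl/= /dnbhs/within/= => /nbhs_ballP[e /= e0 He].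
  (* [e / 2] stays in the ball where the quotient exceeds [c]; [2^-1] keeps the step shorter than a
     period. *)
  exists (Num.min (e / 2) 2^-1).
  have k0 : 0 < Num.min (e / 2) 2^-1 :> R by rewrite lt_min !divr_gt0//= invr_gt0.
  rewrite gt_eqF// gtr0_norm//; split => //.
    by rewrite gt_min; apply/orP; right; lra.
  apply: He; last by rewrite gt_eqF.
  rewrite /ball/= sub0r normrN gtr0_norm// gt_min; apply/orP; left; lra.
have [_ f_lt _] := gt_lift a w Ja.
rewrite normrM normrV ?unitfE// mulrC ltr_pdivlMr ?normr_gt0// in hc.
have [h0|h0] := ltP 0 h.
  exists a, x, (h + x); rewrite addrK; split => //; first lra.
    by move: h1; rewrite gtr0_norm//; lra.
  by move: hc; rewrite !gtr0_norm// subr_gt0 f_lt//; lra.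
have {}h0 : h < 0 by rewrite lt_neqAle hn0.
exists a, (h + x), x; split => //; first lra.
  by move: h1; rewrite ltr0_norm//; lra.
by move: hc; rewrite !ltr0_norm// ?subr_lt0 ?f_lt//; lra.
Qed.

Lemma near_circle_dist a w (d : R) : J a -> 0 < d ->
  \forall w' \near w, forall s, circle_dist (g a w s) (g a w' s) < d.
Proof.
move=> Ja d0.
have /subspace_continuousP /(_ (a, w) (conj Ja I)) := g_cont.
move=> /(_ [set h | forall s, circle_dist (g a w s) (h s) < d]).
case.
  apply/uniform_nbhs; exists [set p | ball p.1 d p.2]; split.
    exact: (entourage_ball _ (PosNum d0)).
  by move=> h H s; exact: H.
move=> [U V] [/= nU nV] UV; apply: filterS nV => w' Vw'.
apply: (UV (a, w')); last by [].
by split => //; exact: nbhs_singleton.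
Qed.

(* The increments of a lift are continuous in [w], even though nothing but
   measurability is known of the lift itself; so [max_slope], a supremum of
   increment quotients, is lower semicontinuous. *)
Lemma open_max_slope_gt (c : R) : open [set w | c < max_slope J gt w].
Proof.
have [c2|c2] := ltP c 2.
  have -> : [set w | c < max_slope J gt w] = setT.
    by apply/seteqP; split => // w _ /=; rewrite (lt_le_trans c2)// max_slope_ge2.
  exact: openT.
rewrite openE => w /= /(max_slope_gtP _ _ c2)[a [p [q [Ja pq qp1 slope]]]].
have D1 := lift_lt1 _ _ _ (g_inj a w Ja) (gt_lift a w Ja) _ _ (ltW pq) qp1.
have [_ f_lt _] := gt_lift a w Ja; have D0 := f_lt _ _ pq.
pose D := gt a w q - gt a w p.
(* The first two terms are the margins of [lift_increment_close]; the third keeps the perturbed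
   increment above [c * (q - p)]. *)
pose d := Num.min (Num.min D (1 - D)) (D - c * (q - p)) / 2.
have d0 : 0 < d by rewrite divr_gt0// !lt_min; apply/andP; split;
  [apply/andP; split|]; rewrite /D; lra.
have dE : 2 * d = Num.min (Num.min D (1 - D)) (D - c * (q - p)).
  by rewrite mulrC divfK.
apply: filterS (near_circle_dist _ _ _ Ja d0) => w' close /=.
apply/(max_slope_gtP _ _ c2); exists a, p, q; split=> //.
have := @lift_increment_close R _ _ _ _ p q d (g_inj a w Ja) (g_inj a w' Ja)
  (gt_lift a w Ja) (gt_lift a w' Ja) pq qp1.
rewrite dE -/D !ge_min !lexx/= ?orbT/= => /(_ isT isT close).
rewrite lt_min => /andP[_]; rewrite ltr_norml => /andP[+ _]; rewrite opprB; lra.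
Qed.

Lemma measurable_ln_max_slope :
  measurable_fun [set: borel M] (fun w : borel M => ln (max_slope J gt w)).
Proof.
apply: (measurableT_comp (@measurable_ln R)).
apply: (measurability _ (RGenOInfty.measurableE R)).
move=> _ [_ [c ->]] <-; rewrite setTI; apply: sub_sigma_algebra.
have -> : (fun w : M => max_slope J gt w) @^-1` [set` `]c, +oo[] =
  [set w | c < max_slope J gt w] by apply/seteqP; split=> w /=; rewrite in_itv/= andbT.
exact: open_max_slope_gt.
Qed.

End Measurability.

(** * Integrals of time averages under an invariant measure *)

Section InvariantIntegral.
Variables (R : realType) (M : pointedMetricType R).
Variables (mu : probability (borel M) R) (sigma : M -> M).
Hypotheses (sigma_cont : continuous sigma) (mu_inv : invariant_measure mu sigma).

Lemma measurable_iter n :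
  measurable_fun [set: borel M] (fun w : borel M => iter n sigma w : borel M).
Proof.
elim: n => [|n IHn]; first exact: measurable_id.
have ms : measurable_fun [set: borel M] (sigma : borel M -> borel M).
  apply: (@measurability _ _ (borel M) (borel M) _ _ (@open M)) => // _ [A oA <-].
  rewrite setTI; apply: sub_sigma_algebra.
  by apply: open_comp oA => x _; exact: sigma_cont.
exact: (measurableT_comp ms IHn).
Qed.

Lemma invariant_iter n (A : set (borel M)) : measurable A ->
  mu (iter n sigma @^-1` A) = mu A.
Proof.
elim: n A => [//|n IHn] A mA.
rewrite -(mu_inv A mA) -(IHn (sigma @^-1` A))//.
by have := measurable_iter 1 measurableT A mA; rewrite setTI.
Qed.

Lemma integral_iter n (f : borel M -> \bar R) :
  measurable_fun [set: borel M] f -> (forall w, 0 <= f w)%E ->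
  (\int[mu]_w f (iter n sigma w) = \int[mu]_w f w)%E.
Proof.
move=> mf f0.
have := @ge0_integral_pushforward _ _ (borel M) (borel M) R _
  (measurable_iter n) mu setT f measurableT mf (fun y _ => f0 y).
rewrite preimage_setT => <-.
apply: eq_measure_integral => [|mi A mA _].
  exact: measurable_iter.
exact: invariant_iter.
Qed.


Lemma le_limn_einf (u v : nat -> \bar R) : (forall n, u n <= v n)%E ->
  (limn_einf u <= limn_einf v)%E.
Proof.
move=> uv; rewrite !limn_einf_lim; apply: lee_lim; [exact: is_cvg_einfs..|].
apply: nearW => n; apply: le_ereal_inf_tmp => _ [k /= nk <-].
by apply: le_trans (uv k); apply: ereal_inf_lbound; exists k.
Qed.

Lemma measurable_limn_einf (h : nat -> borel M -> \bar R) :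
  (forall n, measurable_fun [set: borel M] (h n)) ->
  measurable_fun [set: borel M] (fun w => limn_einf (h^~ w)).
Proof.
move=> mh; apply: (@emeasurable_fun_cvg _ _ _ _
  (fun n w => einfs (h^~ w) n)).
  exact: measurable_fun_einfs.
by move=> w _; rewrite limn_einf_lim; exact: is_cvg_einfs.
Qed.

Lemma cvg_average (k i d : R) :
  n%:R^-1 * (k * (n%:R * i) + d) @[n --> \oo] --> k * i.
Proof.
(* The shift skips [n = 0], where [n%:R^-1] is 0 and the identity below may fail. *)
rewrite -cvg_shiftS/=.
rewrite [X in X @ _](_ : _ = fun n => k * i + n.+1%:R^-1 * d); last first.
  by apply/funext => n; field; rewrite addrC natr1 pnatr_eq0.
suff : k * i + n.+1%:R^-1 * d @[n --> \oo] --> k * i + 0 * d.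
  by rewrite mul0r addr0.
apply: cvgD; first exact: cvg_cst.
by apply: cvgMl; exact: cvg_harmonic.
Qed.

(** Almost everywhere [r] is at most the limit inferior of the averages [h n]. Fatou's lemma bounds
    its integral by the limit of their integrals, which invariance computes exactly. *)
Lemma ae_average_bound (f : borel M -> R) (u : nat -> borel M -> R)
    (r k d : R) :
  measurable_fun [set: borel M] f -> (forall w, 0 <= f w) ->
  (\int[mu]_w (f w)%:E < +oo)%E -> 0 <= r -> 0 <= k -> 0 <= d ->
  (forall n w, u n w <= k * (\sum_(i < n) f (iter i sigma w)) + d) ->
  {ae mu, forall w, u n w / n%:R @[n --> \oo] --> r} ->
  r <= k * fine (\int[mu]_w (f w)%:E).
Proof.
move=> mf f0 foo r0 k0 d0 uf ur.
have intc x : (\int[mu]_w cst x%:E w = x%:E)%E.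
  rewrite integral_cst// -[RHS]mule1; congr (_ * _)%E.
  exact: probability_setT.
set I := fine _; have IE : (\int[mu]_w (f w)%:E)%E = I%:E.
  by rewrite fineK// ge0_fin_numE//; apply: integral_ge0 => w _; rewrite lee_fin.
pose S n w := \sum_(i < n) f (iter i sigma w).
pose h n (w : borel M) := (n%:R^-1 * (k * S n w + d))%:E.
have S0 n w : 0 <= S n w by apply: sumr_ge0.
have mS n : measurable_fun [set: borel M] (S n).
  apply: measurable_sum => i.
  exact: (measurableT_comp mf (measurable_iter i)).
have mh n : measurable_fun [set: borel M] (h n).
  apply/measurable_EFinP.
  apply: measurable_funM => //.
  apply: measurable_funD => //.
  exact: measurable_funM.
have h0 n w : (0 <= h n w)%E.
  by rewrite lee_fin mulr_ge0// ?invr_ge0// addr_ge0// mulr_ge0.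
have intS n : (\int[mu]_w (S n w)%:E = (n%:R * I)%:E)%E.
  under eq_integral do rewrite /S -sumEFin.
  rewrite ge0_integral_sum//; first last.
  - by move=> i w _; rewrite lee_fin.
  - move=> i; apply/measurable_EFinP.
    exact: (measurableT_comp mf (measurable_iter i)).
  rewrite (eq_bigr (fun=> I%:E)); last first.
    move=> i _; rewrite -IE; apply: (integral_iter i (EFin \o f)).
      exact/measurable_EFinP.
    by move=> w; rewrite lee_fin.
  by rewrite sumEFin sumr_const card_ord mulr_natl.
have inth n : (\int[mu]_w h n w = (n%:R^-1 * (k * (n%:R * I) + d))%:E)%E.
  rewrite /h; under eq_integral do rewrite EFinM EFinD EFinM.
  have mkS : measurable_fun [set: borel M] (fun w => (k%:E * (S n w)%:E)%E).
    under eq_fun do rewrite -EFinM.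
    by apply/measurable_EFinP; exact: measurable_funM.
  rewrite ge0_integralZl//; first last.
  - by move=> w _; rewrite -EFinM -EFinD lee_fin addr_ge0// mulr_ge0.
  - by apply: emeasurable_funD.
  rewrite ge0_integralD//; first last.
  - by move=> w _; rewrite -EFinM lee_fin mulr_ge0.
  rewrite ge0_integralZl//; first last.
  - by move=> w _; rewrite lee_fin.
  - exact/measurable_EFinP.
  by rewrite intS intc -EFinM.
have lim_r w : u n w / n%:R @[n --> \oo] --> r -> (r%:E <= limn_einf (h^~ w))%E.
  move=> uwr.
  have /cvg_limn_einf_sup[<- _] : (u n w / n%:R)%:E @[n --> \oo] --> r%:E.
    by apply: cvg_EFin => //; exact: nearW.
  apply: le_limn_einf => n.
  by rewrite lee_fin mulrC ler_wpM2l ?invr_ge0.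
have : (\int[mu]_w (cst r%:E w) <= (k * I)%:E)%E.
  have inthl : (fun n => \int[mu]_w h n w)%E @ \oo --> (k * I)%:E.
    under eq_fun do rewrite inth.
    apply: cvg_EFin; [exact: nearW|exact: cvg_average].
  (* The limit [k * I] is rewritten as a limit inferior, the form in which Fatou's lemma delivers
     its bound. *)
  have [<- _] := cvg_limn_einf_sup inthl.
  apply: le_trans (fatou mu measurableT mh (fun n w _ => h0 n w)).
  apply: ae_ge0_le_integral => //.
  - move=> w _; have [<- _] := @cvg_limn_einf_sup R (cst 0%E) _ (cvg_cst _).
    by apply: le_limn_einf => n; exact: h0.
  - exact: measurable_limn_einf.
  - by apply: filterS ur => w /lim_r.
by rewrite intc lee_fin.
Qed.

End InvariantIntegral.

(** * Log-Hölder continuity of the rotation number *)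

Theorem theorem2p5 (R : realType) (M : pointedMetricType R)
  (M_compact : compact [set: M])
  (sigma : M -> M) (sigma_homeo : homeomorphism sigma)
  (mu : probability (borel M) R) (mu_ergodic : ergodic mu sigma)
  (j0 j1 : R) (j01 : j0 <= j1)
  (J : set R) (JE : J = [set` `[j0, j1]])
  (g : R -> M -> circle R -> circle R)
  (g_homeo : forall a w, J a -> homeo_plus (g a w))
  (g_cont : {within J `*` [set: M], continuous
    (fun p : R * M => (g p.1 p.2 : {uniform circle R -> circle R}))})
  (gt : R -> M -> R -> R)
  (gt_lift : forall a w, J a -> is_lift (gt a w) (g a w))
  (gt_cont : forall w,
    {within J, continuous (fun a : R => (gt a w : {uniform R -> R}))})
  (gt_bounded : forall a, J a -> bounded_fun (fun w : M => gt a w 0))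
  (gt_measurable : forall a, J a ->
    measurable_fun [set: borel M] (fun w : borel M => gt a w 0))
  (gt_C1 : forall w, C1_strip J (fun a x => gt a w x))
  (C : R) (C_gt0 : 0 < C)
  (gt_da : forall x w a, J a -> `|derive_in J (fun b => gt b w x) a| <= C)
  (gt_dx : (\int[mu]_w (ln (max_slope J gt w))%:E < +oo)%E)
  (rho : R -> R)
  (rhoP : forall a, J a -> is_rotation_number mu sigma gt a (rho a)) :
  exists K : R, 0 < K /\
    forall a a', J a -> J a' -> `|a - a'| <= 2^-1 ->
      `|rho a' - rho a| <= K * (ln (`|a' - a|^-1))^-1.
Proof.
subst J; set J := [set` `[j0, j1]].
have g_inj a w : J a -> injective (g a w).
  by move=> /(g_homeo a w)[[_ [h [_ gK _]]] _]; exact: can_inj gK.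
have [sigma_cont _] := sigma_homeo; have [mu_inv _] := mu_ergodic.
pose f (w : borel M) := ln (max_slope J gt w).
have f0 w : 0 <= f w.
  by rewrite ln_ge0// (le_trans _ (max_slope_ge2 _ _ _ gt w))// ler1n.
(* [C] is replaced by a larger integer, so that the restart scale is one that lifts preserve. *)
pose c := Num.bound C.
have Cc : C < c%:R by apply: archi_boundP; exact: ltW.
have c_gt0 : (0 < c)%N by rewrite -(ltr0n R) (lt_trans C_gt0).
pose I := fine (\int[mu]_w (f w)%:E).
have I0 : 0 <= I by apply: fine_ge0; apply: integral_ge0 => w _; rewrite lee_fin.
(* The summand 1 makes the constant positive from [0 <= I] alone. *)
exists (2 * c%:R * I + 1); split; first by rewrite ltr_wpDl// mulr_ge0.
move=> a a' Ja Ja' aa'.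
(* For [a = a'] the conventions [0^-1 = 0] and [ln 0 = 0] make the right-hand side 0, and so is the
   left. *)
have [<-|neq] := eqVneq a a'.
  by rewrite !subrr normr0 invr0 ln0// invr0 mulr0.
have e_gt0 : 0 < `|a' - a| by rewrite normr_gt0 subr_eq0 eq_sym.
have e_lt1 : `|a' - a| < 1 by rewrite distrC (le_lt_trans aa')// invf_lt1// ltr1n.
have L_gt0 : 0 < ln `|a' - a|^-1 by rewrite ln_gt0// invf_gt1.
rewrite ler_pdivlMr// (@le_trans _ _ (2 * c%:R * I))//; last by rewrite lerDl.
(* The gap is multiplied by the fixed number [ln e^-1], with [e] the distance of the parameters, so
   the constant [2 * c%:R] in front of the Birkhoff sum is independent of [a] and [a']. *)
apply: (@ae_average_bound R M mu sigma sigma_cont mu_inv f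
  (fun n w => `|lift_iter sigma gt n a' w 0 - lift_iter sigma gt n a w 0| *
     ln `|a' - a|^-1) _ (2 * c%:R) (c%:R * ln `|a' - a|^-1)) => //.
- exact: (@measurable_ln_max_slope R M j0 j1 j01 g gt).
- by rewrite mulr_ge0// ltW.
- by rewrite mulr_ge0// ltW.
- move=> n w.
  apply: (@orbit_gap R (fun i => gt a (iter i sigma w))
    (fun i => gt a' (iter i sigma w)) (fun i => max_slope J gt (iter i sigma w))
    c _ c_gt0 e_gt0 e_lt1 _ _ _ _ (fun i => lift_iter sigma gt i a w 0)
    (fun i => lift_iter sigma gt i a' w 0)) => //.
  + by move=> i; exact: max_slope_ge2.
  + move=> i x y.
    exact: (@lip_max_slope R M j0 j1 g gt).
  + move=> i x y k.
    exact: (lift_int_gap _ _ _ (g_inj _ _ Ja') (gt_lift _ _ Ja')).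
  + move=> i x.
    apply: (@le_trans _ _ (C * `|a' - a|)); last by rewrite ler_wpM2r// ltW.
    have [gt_da_ex _ _ _] := gt_C1 (iter i sigma w).
    (* The bound on the parameter derivative, at fixed [x] and base point, gives the error of one
       step. *)
    apply: (@lip_of_derive_in R j0 j1 J (fun b => gt b (iter i sigma w) x)) => //.
    * exact: (@pointwise_cont R _ J (fun b => gt b (iter i sigma w))).
    * by move=> b Jb; exact: gt_da_ex.
    * by move=> b Jb; exact: gt_da.
- apply: filterS2 (rhoP a Ja) (rhoP a' Ja') => w /(_ 0) cvga /(_ 0) cvga'.
  under eq_fun do rewrite mulrAC.
  apply: cvgMl; rewrite [X in X @ _](_ : _ = fun n : nat =>
    `|(lift_iter sigma gt n a' w 0 - 0) / n%:R -
      (lift_iter sigma gt n a w 0 - 0) / n%:R|).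
    by apply: cvg_norm; exact: cvgB.
  apply/funext => n; rewrite !subr0 -mulrBl normrM; congr (_ * _).
  by rewrite ger0_norm// invr_ge0.
Qed.
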